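(* Let $L$ be a non-abelian finite-dimensional Lie algebra over a finite field $\mathbb{F}_q$. Then the diameter of the non-commuting graph $G_L$ is at most $2$.
   Context: $\mathbb{F}_q$ denotes the finite field with $q$ elements. For a Lie algebra $L$, $Z(L)=\{x\in L : [x,y]=0 \text{ for all } y\in L\}$ is its centre. The non-commuting graph $G_L$ is the undirected simple graph with vertex set $L\setminus Z(L)$, in which two distinct vertices $x$ and $y$ are adjacent if and only if $[x,y]\neq 0$. The diameter of a graph is the largest distance (length of a shortest path) between pairs of its vertices. *)

(* Defs.v *)
From HB Require Import structures.
From mathcomp Require Import all_boot all_order all_algebra all_field.

Set Implicit Arguments.
Unset Strict Implicit.
Unset Printing Implicit Defensive.

Import GRing.Theory.
Local Open Scope ring_scope.

HB.mixin Record Lmodule_isLie (F : fieldType) L of GRing.Lmodule F L := {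
  lie : L -> L -> L;
  lie_linearl : forall y, linear (fun x => lie x y);
  lie_linearr : forall x, linear (lie x);
  liexx : forall x, lie x x = 0;
  lie_jacobi : forall x y z,
    lie x (lie y z) + lie y (lie z x) + lie z (lie x y) = 0
}.

#[short(type="lieAlgType")]
HB.structure Definition LieAlgebra (F : fieldType) :=
  {L of GRing.Lmodule F L & Lmodule_isLie F L}.

(* Finite-dimensional Lie algebras. *)
#[short(type="lieVectType")]
HB.structure Definition LieVector (F : fieldType) :=
  {L of Vector F L & Lmodule_isLie F L}.

Notation "[| x , y |]" := (lie x y)
  (at level 0, x, y at level 99, format "[|  x ,  y  |]") : ring_scope.

Definition lie_abelian (F : fieldType) (L : lieAlgType F) : Prop :=
  forall x y : L, [| x, y |] = 0.

Lemma lie_antisym (F : fieldType) (L : lieAlgType F) (x y : L) :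
  [| x, y |] = - [| y, x |].
Proof.
have Dl a b c : [| a + b, c |] = [| a, c |] + [| b, c |] :> L.
  by have := lie_linearl c 1 a b; rewrite !scale1r.
have Dr a b c : [| a, b + c |] = [| a, b |] + [| a, c |] :> L.
  by have := lie_linearr a 1 b c; rewrite !scale1r.
have := liexx (x + y); rewrite Dl !Dr !liexx add0r addr0.
by move/eqP; rewrite addr_eq0 => /eqP.
Qed.

(* [finvect_type L] is [L] itself, with the [finType] structure that a
   finite-dimensional space over a finite field carries. *)
Definition lie_center (F : finFieldType) (L : lieVectType F) :
    {set finvect_type L} :=
  [set x : finvect_type L | [forall y : finvect_type L, [| (x : L), (y : L) |] == 0]].

Record sgraph := SGraph {
  vertex :> finType;
  adj : rel vertex;
  adj_sym : symmetric adj;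
  adj_irrefl : irreflexive adj
}.

Section Diameter.

Variable G : sgraph.
Implicit Types x y : G.

Definition has_walk x y (n : nat) : Prop :=
  exists p : seq G, [/\ path (@adj G) x p, last x p = y & size p = n].

Definition is_distance x y (n : nat) : Prop :=
  has_walk x y n /\ forall m, has_walk x y m -> (n <= m)%N.

(* Holds for no [d] when [G] is disconnected (infinite diameter) or empty. *)
Definition is_diameter (d : nat) : Prop :=
  (forall x y, exists2 n, is_distance x y n & (n <= d)%N) /\
  (exists x y, is_distance x y d).

End Diameter.

Section NonCommutingGraph.

Variables (F : finFieldType) (L : lieVectType F).

Definition noncentral : finType :=
  {x : finvect_type L | x \in ~: lie_center L}.

Definition noncommuting : rel noncentral :=
  fun x y => (x != y) && ([| (val x : L), (val y : L) |] != 0).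

Lemma noncommuting_sym : symmetric noncommuting.
Proof.
by move=> x y; rewrite /noncommuting eq_sym lie_antisym oppr_eq0.
Qed.

Lemma noncommuting_irrefl : irreflexive noncommuting.
Proof. by move=> x; rewrite /noncommuting eqxx. Qed.

Definition noncommuting_graph : sgraph :=
  SGraph noncommuting_sym noncommuting_irrefl.

End NonCommutingGraph.

(* Main.v *)
Require Import Defs.
From HB Require Import structures.
From mathcomp Require Import all_boot all_order all_algebra all_field.

Set Implicit Arguments.
Unset Strict Implicit.
Unset Printing Implicit Defensive.

(** Any two non-central elements x and y have a common neighbour, because the
    centralizers of x and y are proper additive subgroups of L and no group is
    the union of two proper subgroups: an element outside both commutes with
    neither x nor y, hence is itself non-central.  This is
    [common_noncommuting].

    So any two vertices of the graph are joined by a walk of length 2, and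
    distances are at most 2.  A non-abelian L has a non-central element, so the
    graph is a nonempty finite graph, and the largest of its distances, which
    is its diameter, exists ([diameter_bounded]). *)

Import GRing.Theory.
Local Open Scope ring_scope.

Section BoundedDiameter.

Variable G : sgraph.

(** Walks of a fixed length form a finite type, so the existence of one can be
    decided; this is what allows the minimal length to be computed. *)
Lemma has_walkP (x y : G) n :
  reflect (has_walk x y n)
    [exists p : n.-tuple G, path (@adj G) x p && (last x p == y)].
Proof.
apply: (iffP existsP) => [[p /andP[xp /eqP py]] | [p [xp py /eqP szp]]].
  by exists p; rewrite size_tuple.
by exists (Tuple szp); rewrite /= xp py eqxx.
Qed.

Lemma distance_le_walk (x y : G) n :
  has_walk x y n -> exists2 m, is_distance x y m & (m <= n)%N.
Proof.
move=> walk_n.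
have ex_walk : exists m,
    [exists p : m.-tuple G, path (@adj G) x p && (last x p == y)].
  by exists n; apply/has_walkP.
case: (ex_minnP ex_walk) => m /has_walkP walk_m min_m.
exists m; last by apply: min_m; apply/has_walkP.
by split=> // k /has_walkP /min_m.
Qed.

(** Nonemptiness is essential: the diameter has to be attained by some pair of
    vertices. *)
Lemma diameter_bounded d (x0 : G) :
    (forall x y : G, exists2 n, has_walk x y n & (n <= d)%N) ->
  exists2 e, is_diameter G e & (e <= d)%N.
Proof.
move=> short_walk.
have dist_xy (u : G * G) : exists n, is_distance u.1 u.2 n /\ (n <= d)%N.
  have [n /distance_le_walk[m dist_m le_mn] le_nd] := short_walk u.1 u.2.
  by exists m; split=> //; apply: leq_trans le_nd.
have [dist distP] := fin_all_exists dist_xy.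
have [[a b] max_ab] : {u | \max_v dist v = dist u}.
  by apply: eq_bigmax; apply/card_gt0P; exists (x0, x0).
exists (dist (a, b)); last exact: (distP (a, b)).2.
split=> [x y | ]; last by exists a, b; exact: (distP (a, b)).1.
exists (dist (x, y)); first exact: (distP (x, y)).1.
by rewrite -max_ab; apply: leq_bigmax.
Qed.

End BoundedDiameter.

Section NonCommuting.

Variables (F : finFieldType) (L : lieVectType F).

Lemma lieDr (x y z : L) : [| x, y + z |] = [| x, y |] + [| x, z |].
Proof. by have := lie_linearr x 1 y z; rewrite !scale1r. Qed.

Lemma noncentralP (x : finvect_type L) :
  reflect (exists y : L, [| (x : L), y |] != 0) (x \in ~: lie_center L).
Proof.
rewrite !inE negb_forall; apply: (iffP existsP) => -[y xy]; by exists y.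
Qed.

(** The witness is a if [y, a] <> 0, or b if [x, b] <> 0; when both of these
    brackets vanish, [x, a + b] = [x, a] and [y, a + b] = [y, b]. *)
Lemma common_noncommuting (x y a b : L) :
    [| x, a |] != 0 -> [| y, b |] != 0 ->
  exists z : L, [| x, z |] != 0 /\ [| y, z |] != 0.
Proof.
move=> xa yb.
have [ya | ya] := eqVneq [| y, a |] 0; last by exists a.
have [xb|xb] := eqVneq [| x, b |] 0; last by exists b.
by exists (a + b); rewrite !lieDr ya xb addr0 add0r.
Qed.

Lemma noncommutingE (x y : noncentral L) :
  noncommuting x y = ([| (val x : L), (val y : L) |] != 0).
Proof.
rewrite /noncommuting; have [->|//] := eqVneq x y.
by rewrite liexx eqxx.
Qed.

Lemma walk2_noncommuting (x y : noncommuting_graph L) : has_walk x y 2.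
Proof.
have [a xa] := noncentralP _ (valP x); have [b yb] := noncentralP _ (valP y).
have [z [xz yz]] := common_noncommuting xa yb.
have z_nc : (z : finvect_type L) \in ~: lie_center L.
  by apply/noncentralP; exists (val x : L); rewrite lie_antisym oppr_eq0.
pose v : noncommuting_graph L := Sub (z : finvect_type L) z_nc.
exists [:: v; y]; split=> //=.
by rewrite [X in _ && (X && _)]noncommuting_sym !noncommutingE /= xz yz.
Qed.

Lemma exists_noncentral : ~ lie_abelian L -> inhabited (noncentral L).
Proof.
move=> nab.
have [x x_nc|none] := pickP [pred x : finvect_type L | x \in ~: lie_center L].
  by split; exists x.
case: nab => x y; apply/eqP; apply: contraFT (none (x : finvect_type L)) => xy.
by apply/noncentralP; exists y.
Qed.

End NonCommuting.

Theorem proposition2p6 (F : finFieldType) (L : lieVectType F)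
    (L_nonabelian : ~ lie_abelian L) :
  exists2 d : nat, is_diameter (noncommuting_graph L) d & (d <= 2)%N.
Proof.
have [x0] := exists_noncentral L_nonabelian.
apply: (@diameter_bounded (noncommuting_graph L) 2 x0) => x y.
by exists 2%N => //; apply: walk2_noncommuting.
Qed.
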